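(* Let $d\ge1$, $\eta>0$, and let $f\in S(\mu_f,L_f)$, $\phi\in S(\mu_\phi,L_\phi)$ be functions $\mathbb{R}^d\to\mathbb{R}$ with $0<\mu_f\le L_f$ and $0<\mu_\phi\le L_\phi$. Let $\bar\phi$ be the convex conjugate of $\phi$, and let the matrices $\hat A,\hat B,\hat C,\hat D,M_s,M_w$ (which depend on $\eta,\mu_f,L_f,\mu_{\bar\phi},L_{\bar\phi}$, on a parameter $\bar\rho\ge0$, and on $\alpha,\beta$) be as defined in the context. Let $0\le\bar\rho\le\rho\le1$. Suppose there exist a symmetric positive definite matrix $P\in\mathbb{R}^{5d\times5d}$ and matrices $\alpha=\mathrm{diag}(\alpha_1,\alpha_2)\otimes I_d$, $\beta=\mathrm{diag}(\beta_1,\beta_2)\otimes I_d$ with $\alpha_1,\alpha_2,\beta_1,\beta_2\ge0$ such that $$\begin{bmatrix}\hat A^TP\hat A-\rho^2P&\hat A^TP\hat B \\ \hat B^TP\hat A&\hat B^TP\hat B\end{bmatrix}+\begin{bmatrix}\hat C&\hat D\end{bmatrix}^T\begin{bmatrix}M_s&0 \\ 0&M_w\end{bmatrix}\begin{bmatrix}\hat C&\hat D\end{bmatrix}\le0 .$$ Then the discrete-time mirror descent algorithm $$z_{k+1}=z_k-\eta\,(\nabla f\circ\nabla\bar\phi)(z_k),\qquad x_k=\nabla\bar\phi(z_k),$$ converges with rate $\rho$.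
   Context: For $0\le\mu\le L$, $S(\mu,L)$ is the set of continuously differentiable functions $h:\mathbb{R}^d\to\mathbb{R}$ that are $\mu$-strongly convex and $L$-smooth, i.e. $\mu\|x-y\|^2\le(\nabla h(x)-\nabla h(y))^T(x-y)\le L\|x-y\|^2$ for all $x,y$. The convex conjugate of $\phi$ is $\bar\phi(z)=\sup_x\{x^Tz-\phi(x)\}$. Set $\mu_{\bar\phi}=L_\phi^{-1}$, $L_{\bar\phi}=\mu_\phi^{-1}$. Then $\bar\phi\in S(\mu_{\bar\phi},L_{\bar\phi})$ and $\nabla\bar\phi$ is the inverse function of $\nabla\phi$. Let $x^{\mathrm{opt}}$ be the minimizer of $f$ over $\mathbb{R}^d$ and $z^{\mathrm{opt}}=\nabla\phi(x^{\mathrm{opt}})$. Convergence with rate $\rho$ means: there is a constant $c>0$ such that for every $z_0\in\mathbb{R}^d$, $\|z_k-z^{\mathrm{opt}}\|\le c\,\rho^k\|z_0-z^{\mathrm{opt}}\|$ for all $k\ge0$. Define $$A=(1-\eta\mu_f\mu_{\bar\phi})I_d,\quad B=\begin{bmatrix}-\eta I_d&-\eta\mu_fI_d\end{bmatrix},\quad C=\begin{bmatrix}\mu_{\bar\phi}I_d \\ I_d\end{bmatrix},\quad D=\begin{bmatrix}0_d&I_d \\ 0_d&0_d\end{bmatrix},$$ and $K=\mathrm{diag}(L_f-\mu_f,\;L_{\bar\phi}-\mu_{\bar\phi})\otimes I_d\in\mathbb{R}^{2d\times2d}$. Define $$M_s=\begin{bmatrix}0_{2d}&\alpha \\ \alpha&0_{2d}\end{bmatrix},\qquad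 M_w=\begin{bmatrix}0_{2d}&\beta \\ \beta&0_{2d}\end{bmatrix},$$ $$A_{\Psi_s}=0_{2d},\ B^y_{\Psi_s}=0_{2d},\ B^u_{\Psi_s}=0_{2d},\ C_{\Psi_s}=\begin{bmatrix}0_{2d} \\ 0_{2d}\end{bmatrix},\ D^y_{\Psi_s}=\begin{bmatrix}K \\ 0_{2d}\end{bmatrix},\ D^u_{\Psi_s}=\begin{bmatrix}-I_{2d} \\ I_{2d}\end{bmatrix},$$ $$A_{\Psi_w}=0_{2d},\ B^y_{\Psi_w}=-K,\ B^u_{\Psi_w}=I_{2d},\ C_{\Psi_w}=\begin{bmatrix}\bar\rho^2I_{2d} \\ 0_{2d}\end{bmatrix},\ D^y_{\Psi_w}=\begin{bmatrix}K \\ 0_{2d}\end{bmatrix},\ D^u_{\Psi_w}=\begin{bmatrix}-I_{2d} \\ I_{2d}\end{bmatrix}.$$ Finally $$\hat A=\begin{bmatrix}A&0_{d\times2d}&0_{d\times2d} \\ B^y_{\Psi_s}C&A_{\Psi_s}&0_{2d\times2d} \\ B^y_{\Psi_w}C&0_{2d\times2d}&A_{\Psi_w}\end{bmatrix},\qquad \hat B=\begin{bmatrix}B \\ B^y_{\Psi_s}D+B^u_{\Psi_s} \\ B^y_{\Psi_w}D+B^u_{\Psi_w}\end{bmatrix},$$ $$\hat C=\begin{bmatrix}D^y_{\Psi_s}C&C_{\Psi_s}&0_{4d\times2d} \\ D^y_{\Psi_w}C&0_{4d\times2d}&C_{\Psi_w}\end{bmatrix},\qquad \hat D=\begin{bmatrix}D^y_{\Psi_s}D+D^u_{\Psi_s}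 \\ D^y_{\Psi_w}D+D^u_{\Psi_w}\end{bmatrix}.$$ $I_n$, $0_n$ denote $n\times n$ identity and zero matrices, $0_{m\times n}$ the $m\times n$ zero matrix, $\otimes$ the Kronecker product, and $\le0$ for symmetric matrices means negative semidefinite. *)

(* Defs.v *)
From HB Require Import structures.
From mathcomp Require Import all_boot all_order all_algebra.
From mathcomp Require Import all_classical all_reals all_analysis.
From mathcomp Require Import mxtens.

Set Implicit Arguments.
Unset Strict Implicit.
Unset Printing Implicit Defensive.

Import Order.TTheory GRing.Theory Num.Theory.
Import numFieldNormedType.Exports.
Local Open Scope classical_set_scope.
Local Open Scope ring_scope.

Section Functions.
Context {R : realType} {d : nat}.
Implicit Types (x y z : 'cV[R]_d) (h f phi : 'cV[R]_d -> R).

Definition dotp x y : R := (x^T *m y) 0 0.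

(* The library norm `|x| on matrices is the sup norm; this is the Euclidean
   norm. *)
Definition enorm x : R := Num.sqrt (dotp x x).

Definition grad h x : 'cV[R]_d := \col_i 'D_(delta_mx i 0) h x.

Definition continuously_differentiable h :=
  (forall x, differentiable h x) /\ continuous (grad h).

Definition S_class (mu L : R) h :=
  continuously_differentiable h /\
  forall x y,
    mu * enorm (x - y) ^+ 2 <= dotp (grad h x - grad h y) (x - y)
      <= L * enorm (x - y) ^+ 2.

(* Real-valued supremum: it is the convex conjugate wherever that conjugate is
   finite, in particular everywhere for a function in S_class mu L with
   0 < mu; `sup` is 0 on sets that are unbounded above. *)
Definition conjugate phi z : R := sup [set dotp x z - phi x | x in setT].

Definition is_minimizer f x := forall y, f x <= f y.

Definition mirror_descent (eta : R) f phi (x z : nat -> 'cV[R]_d) :=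
  forall k : nat,
    x k = grad (conjugate phi) (z k) /\
    z k.+1 = z k - eta *: (grad f \o grad (conjugate phi)) (z k).

(* The constant c is uniform over all trajectories, hence over all z_0. *)
Definition converges_with_rate (eta : R) f phi (zopt : 'cV[R]_d) (rho : R) :=
  exists2 c : R, 0 < c &
    forall x z : nat -> 'cV[R]_d, mirror_descent eta f phi x z ->
    forall k : nat,
      enorm (z k - zopt) <= c * rho ^+ k * enorm (z 0%N - zopt).

End Functions.

Definition quad_form {R : realType} {n : nat} (Q : 'M[R]_n) (v : 'cV[R]_n) : R :=
  dotp v (Q *m v).

Definition sym_posdef {R : realType} {n : nat} (Q : 'M[R]_n) :=
  Q^T = Q /\ forall v : 'cV[R]_n, v != 0 -> 0 < quad_form Q v.

Definition negsemidef {R : realType} {n : nat} (Q : 'M[R]_n) :=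
  forall v : 'cV[R]_n, quad_form Q v <= 0.

(* The dimension 2d is rendered as d + d, 4d as (d + d) + (d + d) and 5d as
   d + (d + d) + (d + d), so that block matrices need no casts. *)
Section Matrices.
Context {R : realType} (d : nat).

(* diag(a, b) (x) I_d; see kdiag_tens for the link with the library's
   Kronecker product. *)
Definition kdiag (a b : R) : 'M[R]_(d + d) := block_mx a%:M 0 0 b%:M.

Lemma kdiag_dim : ((1 + 1) * d = d + d)%N.
Proof. by rewrite mulnDl mul1n. Qed.

Lemma kdiag_tens (a b : R) :
  kdiag a b =
  castmx (kdiag_dim, kdiag_dim)
    ((block_mx a%:M 0 0 b%:M : 'M[R]_(1 + 1)) *t (1%:M : 'M[R]_d)).
Proof.
rewrite tens_block_mx !tens_scalar_mx tens0mx castmx_comp.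
rewrite (castmx_block (mul1n d) (mul1n d) (mul1n d) (mul1n d)).
rewrite !castmx_comp !castmx_id !scalemx1.
by congr block_mx; apply/matrixP => i j; rewrite castmxE !mxE.
Qed.

Context (eta muf Lf mub Lb : R).

Definition Amx : 'M[R]_d := (1 - eta * muf * mub)%:M.
Definition Bmx : 'M[R]_(d, d + d) := row_mx (- eta)%:M (- (eta * muf))%:M.
Definition Cmx : 'M[R]_(d + d, d) := col_mx mub%:M 1%:M.
Definition Dmx : 'M[R]_(d + d) := block_mx 0 1%:M 0 0.
Definition Kmx : 'M[R]_(d + d) := kdiag (Lf - muf) (Lb - mub).

(* Both M_s (with X = alpha) and M_w (with X = beta). *)
Definition Mmx (X : 'M[R]_(d + d)) : 'M[R]_((d + d) + (d + d)) :=
  block_mx 0 X X 0.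

Definition APsi_s : 'M[R]_(d + d) := 0.
Definition ByPsi_s : 'M[R]_(d + d) := 0.
Definition BuPsi_s : 'M[R]_(d + d) := 0.
Definition CPsi_s : 'M[R]_((d + d) + (d + d), d + d) := col_mx 0 0.
Definition DyPsi_s : 'M[R]_((d + d) + (d + d), d + d) := col_mx Kmx 0.
Definition DuPsi_s : 'M[R]_((d + d) + (d + d), d + d) := col_mx (- 1%:M) 1%:M.

Context (rhobar : R).

Definition APsi_w : 'M[R]_(d + d) := 0.
Definition ByPsi_w : 'M[R]_(d + d) := - Kmx.
Definition BuPsi_w : 'M[R]_(d + d) := 1%:M.
Definition CPsi_w : 'M[R]_((d + d) + (d + d), d + d) :=
  col_mx (rhobar ^+ 2)%:M 0.
Definition DyPsi_w : 'M[R]_((d + d) + (d + d), d + d) := col_mx Kmx 0.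
Definition DuPsi_w : 'M[R]_((d + d) + (d + d), d + d) := col_mx (- 1%:M) 1%:M.

Definition Ahat : 'M[R]_(d + (d + d) + (d + d)) :=
  col_mx (col_mx (row_mx (row_mx Amx               0)      0)
                 (row_mx (row_mx (ByPsi_s *m Cmx)  APsi_s) 0))
                 (row_mx (row_mx (ByPsi_w *m Cmx)  0)      APsi_w).

Definition Bhat : 'M[R]_(d + (d + d) + (d + d), d + d) :=
  col_mx (col_mx Bmx
                 (ByPsi_s *m Dmx + BuPsi_s))
                 (ByPsi_w *m Dmx + BuPsi_w).

Definition Chat :
    'M[R]_(((d + d) + (d + d)) + ((d + d) + (d + d)),
           d + (d + d) + (d + d)) :=
  col_mx (row_mx (row_mx (DyPsi_s *m Cmx) CPsi_s) 0)
         (row_mx (row_mx (DyPsi_w *m Cmx) 0)      CPsi_w).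

Definition Dhat : 'M[R]_(((d + d) + (d + d)) + ((d + d) + (d + d)), d + d) :=
  col_mx (DyPsi_s *m Dmx + DuPsi_s)
         (DyPsi_w *m Dmx + DuPsi_w).

Definition LMI_mx (rho : R) (P : 'M[R]_(d + (d + d) + (d + d)))
    (alpha beta : 'M[R]_(d + d)) :
    'M[R]_(d + (d + d) + (d + d) + (d + d)) :=
  block_mx (Ahat^T *m P *m Ahat - rho ^+ 2 *: P) (Ahat^T *m P *m Bhat)
           (Bhat^T *m P *m Ahat)                 (Bhat^T *m P *m Bhat)
  + (row_mx Chat Dhat)^T *m block_mx (Mmx alpha) 0 0 (Mmx beta)
      *m row_mx Chat Dhat.

End Matrices.

(* Main.v *)
Require Import Defs.
From HB Require Import structures.
From mathcomp Require Import all_boot all_order all_algebra.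
From mathcomp Require Import all_classical all_reals all_analysis.
From mathcomp Require Import ring lra.

Set Implicit Arguments.
Unset Strict Implicit.
Unset Printing Implicit Defensive.

Import Order.TTheory GRing.Theory Num.Theory.
Import numFieldNormedType.Exports.
Local Open Scope classical_set_scope.
Local Open Scope ring_scope.

(** Mirror descent is a linear system in closed loop with two gradient maps,
    [grad f] and [grad (conjugate phi)].  Subtracting from each map its value at
    the optimum and its strong-convexity part [m *: (x - a)] leaves the
    [residual] [r], which is the gradient of a convex, [(M - m)]-smooth function
    minimal at the anchor [a].  With the [coresidual]
    [p x = (M - m) *: (x - a) - r x], there is a nonnegative function
    [potential], called [q] below and zero at [a], such that
      [q x - q y <= dotp (r x) (p x - p y)]
    ([potential_increment]).  For [y = a] this is the sector inequality
    [0 <= q x <= dotp (r x) (p x)], and a convex combination of the two cases is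
    the off-by-one inequality
      [q x - rhobar ^+ 2 * q y <= dotp (r x) (p x - rhobar ^+ 2 *: p y)]
    ([potential_discounted_increment]).

    The state of the extended system consists of the error [z k - zopt], the
    state of the sector filter, which stays [0], and minus the two coresiduals of
    the previous step.  Evaluated at this state and at the two residuals, the matrix
    inequality bounds the variation of [quad_form P] along one step by the two
    inner products above ([LMI_dissipation]).  Hence
      [V k = quad_form P (state k) + 2 * (beta1 * q1 + beta2 * q2)],
    with the potentials taken at the previous step, satisfies
    [V k.+1 <= rho ^+ 2 * V k].  Before the first step the previous point is
    taken to be the optimum: coresiduals and potentials vanish there, so [V 0]
    is quadratic in [z 0 - zopt].  Two-sided bounds on [quad_form P]
    ([posdef_quad_form_lower], [quad_form_upper]) then give the rate.

    Only first-order quadratic bounds on the two functions enter this argument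
    ([quad_bounded]).  They follow from the monotonicity of the gradient by the
    mean value theorem ([S_class_quad_bounded]).  For the conjugate they come
    from conjugating the quadratic bounds on [phi] ([conjugate_bounds]), once
    every [z] is known to be a gradient of [phi] ([gradient_surjective]); the
    expansion obtained also identifies [grad (conjugate phi)] with the inverse of
    [grad phi] ([grad_conjugate]). *)

(** * Inner products and quadratic forms *)

Section InnerProduct.
Context {R : realType} {d : nat}.
Implicit Types (x y z a : 'cV[R]_d) (k : R).

Lemma dotpE x y : dotp x y = \sum_i x i 0 * y i 0.
Proof. by rewrite /dotp mxE; apply: eq_bigr => i _; rewrite mxE. Qed.

Lemma dotpC x y : dotp x y = dotp y x.
Proof. by rewrite !dotpE; apply: eq_bigr => i _; rewrite mulrC. Qed.

Lemma dotpDl x y z : dotp (x + y) z = dotp x z + dotp y z.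
Proof. by rewrite /dotp linearD /= mulmxDl mxE. Qed.

Lemma dotpZl k x y : dotp (k *: x) y = k * dotp x y.
Proof. by rewrite /dotp linearZ /= -scalemxAl mxE. Qed.

Lemma dotpNl x y : dotp (- x) y = - dotp x y.
Proof. by rewrite -scaleN1r dotpZl mulN1r. Qed.

Lemma dotpDr x y z : dotp z (x + y) = dotp z x + dotp z y.
Proof. by rewrite !(dotpC z) dotpDl. Qed.

Lemma dotpZr k x y : dotp y (k *: x) = k * dotp y x.
Proof. by rewrite !(dotpC y) dotpZl. Qed.

Lemma dotpNr x y : dotp y (- x) = - dotp y x.
Proof. by rewrite !(dotpC y) dotpNl. Qed.

Lemma dotp0l y : dotp 0 y = 0.
Proof. by rewrite /dotp trmx0 mul0mx mxE. Qed.

Definition dotp_lin := (dotpDl, dotpDr, dotpNl, dotpNr, dotpZl, dotpZr).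

Lemma dotp_ge0 x : 0 <= dotp x x.
Proof. by rewrite dotpE sumr_ge0 // => i _; rewrite -expr2 sqr_ge0. Qed.

Lemma dotp_eq0 x : dotp x x = 0 -> x = 0.
Proof.
move=> /eqP; rewrite dotpE psumr_eq0 => [/allP h|i _]; last first.
  by rewrite -expr2 sqr_ge0.
apply/colP => i; rewrite mxE; apply/eqP.
by have := h i (mem_index_enum _); rewrite /= mulf_eq0 orbb.
Qed.

Lemma dotp_delta x i : dotp x (delta_mx i 0) = x i 0.
Proof.
rewrite dotpE (bigD1 i) //= mxE !eqxx mulr1 big1 ?addr0 // => j ji.
by rewrite mxE (negbTE ji) mulr0.
Qed.

Lemma enormE x : enorm x ^+ 2 = dotp x x.
Proof. by rewrite /enorm sqr_sqrtr // dotp_ge0. Qed.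

End InnerProduct.

(** The polynomial in [t] is minimal at [L^-1]; when [L = 0] it is affine, and a
    nonnegative affine function on the line is constant. *)
Lemma quadric_bound (R : realType) (L s e : R) : 0 <= L -> 0 <= s ->
  (forall t, 0 <= e - t * s + L / 2 * t ^+ 2 * s) -> s <= 2 * L * e.
Proof.
move=> L0 s0 h; have [Lz|Lnz] := eqVneq L 0.
  (* at this t the affine function takes the value -1 *)
  subst L; rewrite mulr0 mul0r leNgt; apply/negP => sp.
  have := h ((e + 1) / s); rewrite !mul0r divfK ?gt_eqF //; lra.
have Lp : 0 < L by rewrite lt_def Lnz.
have := h L^-1.
have -> : e - L^-1 * s + L / 2 * L^-1 ^+ 2 * s = (2 * L * e - s) / (2 * L).
  by field.
by rewrite pmulr_lge0 ?invr_gt0 ?mulr_gt0 // subr_ge0.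
Qed.

(** * Functions between two quadratics *)

Section QuadBounded.
Context {R : realType} {d : nat}.
Implicit Types (x y z a : 'cV[R]_d) (h : 'cV[R]_d -> R) (G : 'cV[R]_d -> 'cV[R]_d).

Definition bregman h G y x := h y - h x - dotp (G x) (y - x).

(** This is [m]-strong convexity and [M]-smoothness of [h] at first order; with [G]
    separate from [grad h], adding a linear function to [h] requires no
    differentiation ([quad_bounded_tilt]). *)
Definition quad_bounded (m M : R) h G := forall x y,
  m / 2 * dotp (y - x) (y - x) <= bregman h G y x
    <= M / 2 * dotp (y - x) (y - x).

Section Residual.
Variables (m M : R) (h : 'cV[R]_d -> R) (G : 'cV[R]_d -> 'cV[R]_d).
Hypotheses (mM : m <= M) (hG : quad_bounded m M h G).

(** Compare the lower quadratic at [x] with the upper quadratic at [y], both at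
    the point [y - t *: w], and optimize over [t].  This covers the degenerate
    case [m = M], where [w] vanishes. *)
Lemma cocoercive x y w : w = G y - G x - m *: (y - x) ->
  dotp w w <=
    2 * (M - m) * (bregman h G y x - m / 2 * dotp (y - x) (y - x)).
Proof.
move=> wdef; apply: quadric_bound; [by rewrite subr_ge0|exact: dotp_ge0|move=> t].
have /andP[lo _] := hG x (y - t *: w).
have /andP[_ up] := hG y (y - t *: w).
have e1 : y - t *: w - y = - (t *: w) by rewrite addrAC subrr add0r.
have e2 : y - t *: w - x = (y - x) - t *: w by rewrite addrAC.
move: lo up; rewrite /bregman e1 e2; move: wdef; set v := y - x => wdef.
have wE : dotp w w = dotp (G y) w - dotp (G x) w - m * dotp v w.
  by rewrite {1}wdef !dotp_lin; ring.
clearbody v; rewrite !dotp_lin (dotpC w v) => lo up.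
nra.
Qed.

Variable a : 'cV[R]_d.

Definition residual x := G x - G a - m *: (x - a).
Definition coresidual x := (M - m) *: (x - a) - residual x.
(** With [g] the convex function whose gradient is [residual], normalized by
    [g a = 0], this is [(M - m) * g x - |residual x|^2 / 2]. *)
Definition potential x :=
  (M - m) * (bregman h G x a - m / 2 * dotp (x - a) (x - a))
  - 2^-1 * dotp (residual x) (residual x).

Lemma residual_anchor : residual a = 0.
Proof. by rewrite /residual !subrr scaler0 subr0. Qed.

Lemma coresidual_anchor : coresidual a = 0.
Proof. by rewrite /coresidual residual_anchor subrr scaler0 subr0. Qed.

Lemma potential_anchor : potential a = 0.
Proof.
by rewrite /potential residual_anchor /bregman !subrr dotpC !dotp0l !mulr0 !subr0 mulr0.
Qed.

(** Cocoercivity for the pair [(y, x)], with the squares completed. *)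
Lemma potential_increment x y :
  potential x - potential y <=
    dotp (residual x) (coresidual x - coresidual y).
Proof.
have /cocoercive : residual y - residual x = G y - G x - m *: (y - x).
  rewrite /residual; apply/colP => i; rewrite !mxE; ring.
have -> : coresidual x - coresidual y =
    (M - m) *: (x - y) - residual x + residual y.
  rewrite /coresidual; apply/colP => i; rewrite !mxE; ring.
have rE v : dotp (residual x) v = dotp (G x) v - dotp (G a) v - m * dotp (x - a) v.
  by rewrite /residual !dotp_lin; ring.
have D := rE (x - y); move: D; rewrite /potential /bregman {rE}.
move: (residual x) (residual y) => rx ry.
rewrite !dotp_lin (dotpC ry rx) (dotpC y x) (dotpC a x) (dotpC a y).
nra.
Qed.

(** The increment inequality from the anchor, where everything vanishes. *)
Lemma potential_le_sector x :
  potential x <= dotp (residual x) (coresidual x).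
Proof.
have := potential_increment x a.
by rewrite potential_anchor coresidual_anchor !subr0.
Qed.

(** The increment inequality towards the anchor, whose residual vanishes. *)
Lemma potential_ge0 x : 0 <= potential x.
Proof.
have := potential_increment a x.
by rewrite potential_anchor residual_anchor dotp0l sub0r oppr_le0.
Qed.

(** Convex combination, with weights [t] and [1 - t], of the increment inequality
    and of the sector inequality. *)
Lemma potential_discounted_increment t x y : 0 <= t <= 1 ->
  potential x - t * potential y <=
    dotp (residual x) (coresidual x - t *: coresidual y).
Proof.
move=> /andP[t0 t1].
have s0 : 0 <= 1 - t by rewrite subr_ge0.
have := ler_wpM2l t0 (potential_increment x y).
have := ler_wpM2l s0 (potential_le_sector x).
move: (potential x) (potential y) (residual x) (coresidual x) (coresidual y).
by move=> qx qy r px py; rewrite !dotp_lin; lra.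
Qed.

End Residual.
End QuadBounded.

(** * From gradient monotonicity to quadratic bounds *)

Section Calculus.
Context {R : realType} {d : nat}.
Implicit Types (x y z v : 'cV[R]_d) (h : 'cV[R]_d -> R).

Lemma col_sum_delta v : v = \sum_i v i 0 *: delta_mx i 0.
Proof.
by rewrite {1}[v]matrix_sum_delta; apply: eq_bigr => i _; rewrite big_ord1.
Qed.

Lemma derive_grad h x v : differentiable h x -> 'D_v h x = dotp (grad h x) v.
Proof.
move=> dh; rewrite deriveE // {1}[v]col_sum_delta linear_sum /= dotpE.
apply: eq_bigr => i _; rewrite linearZ /= mxE deriveE // mulrC.
by [].
Qed.

Lemma is_derive_line h x v (t : R) : differentiable h (x + t *: v) ->
  is_derive t 1 (fun s => h (x + s *: v)) (dotp (grad h (x + t *: v)) v).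
Proof.
move=> dh.
have dl : is_diff t (fun s : R => x + s *: v) ( *:%R^~ v).
  by apply: is_diff_eq; rewrite add0r.
have dhl : is_diff (x + t *: v) h ('d h (x + t *: v)) by exact: DiffDef.
have dc := is_diff_comp dl dhl.
apply: DeriveDef; first by apply: diff_derivable; case: dc.
have -> : (fun s => h (x + s *: v)) = h \o (fun s => x + s *: v) by [].
rewrite deriveE; last by case: dc.
by rewrite diff_val /= scale1r -deriveE // derive_grad.
Qed.

(** Subtract [k / 2 * t ^+ 2 * |y - x|^2] from [h] along the segment from [x] to
    [y]; for [k = m] and [k = M] gradient monotonicity fixes the sign of the
    derivative. *)
Lemma S_class_quad_bounded (m M : R) h : S_class m M h ->
  quad_bounded m M h (grad h).
Proof.
move=> [[dh _] mono] x y; rewrite /bregman; set v := y - x.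
have mvt k : exists2 t, 0 < t < 1 &
    h y - h x - dotp (grad h x) v - k / 2 * dotp v v =
    dotp (grad h (x + t *: v) - grad h x) v - k * t * dotp v v.
  (* mean value theorem on the segment from x to y *)
  pose F := fun s => h (x + s *: v) - (dotp (grad h x) v * s + k / 2 * dotp v v * s ^+ 2).
  have dF (t : R) : is_derive t 1 F
      (dotp (grad h (x + t *: v)) v - (dotp (grad h x) v + k * dotp v v * t)).
    have dhl := is_derive_line (dh (x + t *: v)).
    apply: is_derive_eq; congr (_ - _).
    rewrite !scaler1 /= -[_ *: _]/(_ * _) -mulr2n -(mulr_natl t).
    by congr (_ + _); field.
  have [|t] := @MVT R F _ 0 1 ltr01 (fun t _ => dF t).
    apply: derivable_within_continuous => t _; case: (dF t) => ? _ //.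
  rewrite in_itv /= => t01; rewrite /F => E; exists t => //.
  move: E; rewrite scale1r scale0r addr0 {1}/v (addrC x) subrK.
  rewrite !dotp_lin; lra.
have bound (t : R) : 0 < t ->
    m * t * dotp v v <= dotp (grad h (x + t *: v) - grad h x) v <= M * t * dotp v v.
  move=> t0; have := mono (x + t *: v) x; rewrite enormE addrAC subrr add0r.
  rewrite dotpZr !dotpZl dotpZr => /andP[lo up].
  by rewrite -(ler_pM2l t0) -[X in _ && X](ler_pM2l t0); apply/andP; split; lra.
apply/andP; split.
  have [t /andP[t0 _] E] := mvt m; have /andP[] := bound t t0; lra.
have [t /andP[t0 _] E] := mvt M; have /andP[] := bound t t0; lra.
Qed.

End Calculus.

(** * Minimizers and surjectivity of the gradient *)

Section Minimizers.
Context {R : realType} {d : nat}.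
Implicit Types (x y z v : 'cV[R]_d) (h phi : 'cV[R]_d -> R) (G : 'cV[R]_d -> 'cV[R]_d).

(** A gradient step of length [M^-1] would otherwise decrease [h]. *)
Lemma minimizer_gradient0 (m M : R) h G x : 0 < M -> quad_bounded m M h G ->
  is_minimizer h x -> G x = 0.
Proof.
move=> M0 hG minx; apply: dotp_eq0; apply/eqP; rewrite eq_le dotp_ge0 andbT.
have /andP[_] := hG x (x - M^-1 *: G x).
have := minx (x - M^-1 *: G x).
have -> : x - M^-1 *: G x - x = - (M^-1 *: G x) by rewrite addrAC subrr add0r.
rewrite /bregman; move: (G x) => g; rewrite !dotp_lin => lo.
have : M * (M^-1 * (M^-1 * dotp g g)) = M^-1 * dotp g g.
  by rewrite mulVKf ?gt_eqF.
move=> E up; rewrite -(pmulr_rle0 _ (_ : 0 < M^-1)) ?invr_gt0 //; lra.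
Qed.

Lemma quad_bounded_tilt (m M : R) h G z : quad_bounded m M h G ->
  quad_bounded m M (fun x => h x - dotp z x) (fun x => G x - z).
Proof.
move=> hG x y; have := hG x y.
suff -> : bregman (fun x => h x - dotp z x) (fun x => G x - z) y x =
  bregman h G y x by [].
by rewrite /bregman !dotp_lin; ring.
Qed.

(** Turns minimization over columns into minimization over rows. *)
Lemma continuous_trmx n : continuous (fun v : 'rV[R]_n => v^T : 'cV[R]_n).
Proof.
move=> v; apply: differentiable_continuous.
have -> : (fun v : 'rV[R]_n => v^T) =
    \sum_(i < n) (fun v : 'rV[R]_n => v 0 i *: delta_mx i 0).
  apply/funext => w; rewrite fct_sumE {1}[w^T]matrix_sum_delta.
  by apply: eq_bigr => i _; rewrite big_ord1 mxE.
apply: differentiable_sum => i; apply: differentiableZl; exact: differentiable_coord.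
Qed.

Lemma continuous_dotp z : continuous (fun x => dotp z x).
Proof.
move=> v; apply: differentiable_continuous.
have -> : (fun x => dotp z x) = \sum_(i < d) (fun x => z i 0 *: x i 0).
  by apply/funext => w; rewrite fct_sumE dotpE.
apply: differentiable_sum => i; apply: differentiableZ; exact: differentiable_coord.
Qed.

(** The sublevel set of [h] through [0] is compact, and a minimizer over it is a
    global minimizer. *)
Lemma strongly_convex_minimizer (m M : R) h G : 0 < m -> continuous h ->
  quad_bounded m M h G -> exists x, is_minimizer h x.
Proof.
move=> m0 ch hG.
pose F (v : 'rV[R]_d) := h v^T.
have cF : continuous F.
  by move=> v; apply: (@continuous_comp _ _ _ _ h); [exact: continuous_trmx|exact: ch].
pose A := [set v | F v <= F 0].
have clA : closed A.
  have -> : A = F @^-1` [set t | t <= F 0] by [].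
  by apply: closed_comp; [move=> v _; exact: cF|exact: closed_le].
pose g := G 0.
have bA : bounded_set A.
  (* 4 |g|^2 / m^2 bounds |w|^2 on the sublevel set, and |w_i| <= 1 + |w|^2 *)
  exists (1 + 4 * dotp g g / m ^+ 2); split; first exact: num_real.
  move=> r ltr v; rewrite /A /F /= trmx0 => Fv.
  have /andP[lo _] := hG 0 v^T.
  move: lo; rewrite /bregman subr0 -/g; set w := v^T => lo.
  have sq := dotp_ge0 (2 *: g + m *: w); move: sq.
  rewrite !dotp_lin (dotpC w g) => sq.
  have ww : dotp w w <= 4 * dotp g g / m ^+ 2.
    rewrite ler_pdivlMr ?exprn_gt0 //.
    have : m * (m * dotp w w) <= m * (- 2 * dotp g w).
      rewrite ler_pM2l //; rewrite -/w in Fv; lra.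
    rewrite expr2; lra.
  rewrite [leLHS]/Num.norm /= mx_normrE; apply: bigmax_le => [|[i j] _ /=].
    have := dotp_ge0 w; lra.
  have vw : `|v i j| ^+ 2 <= dotp w w.
    rewrite real_normK ?num_real // dotpE (bigD1 j) //= !mxE ord1 -expr2.
    rewrite lerDl sumr_ge0 // => k _; rewrite -expr2; exact: sqr_ge0.
  have := sqr_ge0 (`|v i j| - 1); nra.
have A0 : A !=set0 by exists 0; rewrite /A /=.
have [v vA minv] := EVT_min_rV A0 (bounded_closed_compact bA clA)
  (continuous_subspaceT cF).
exists v^T => y; have [Ay|nAy] := leP (h y) (F 0).
  by have := minv y^T; rewrite /F trmxK; apply; rewrite inE /A /F /= trmxK.
by move: vA; rewrite inE => vA; apply: le_trans vA (ltW _).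
Qed.

(** A minimizer of [h - dotp z] has gradient [z]. *)
Lemma gradient_surjective (m M : R) h G z : 0 < m -> m <= M -> continuous h ->
  quad_bounded m M h G -> exists x, G x = z.
Proof.
move=> m0 mM ch hG.
have hGz := quad_bounded_tilt z hG.
have chz : continuous (fun x => h x - dotp z x).
  by move=> x; apply: (@continuousB _ _ _ h (dotp z)); [exact: ch|exact: continuous_dotp].
have [x minx] := strongly_convex_minimizer m0 chz hGz.
exists x; apply/subr0_eq.
exact: (minimizer_gradient0 (lt_le_trans m0 mM) hGz minx).
Qed.

End Minimizers.

(** * The convex conjugate *)

Section Conjugate.
Context {R : realType} {d : nat}.
Implicit Types (x y z v : 'cV[R]_d) (h phi : 'cV[R]_d -> R) (G : 'cV[R]_d -> 'cV[R]_d).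

(** Conjugation reverses the order: the supremum defining [conjugate phi z] lies
    between the suprema for the two quadratics that enclose [phi] at [x].  Both
    bounds coincide when [z = G x], which gives the Fenchel equality. *)
Lemma conjugate_bounds (m M : R) phi G x z : 0 < m -> 0 < M ->
  quad_bounded m M phi G ->
  (2 * M)^-1 * dotp (z - G x) (z - G x)
    <= conjugate phi z - (dotp x z - phi x)
    <= (2 * m)^-1 * dotp (z - G x) (z - G x).
Proof.
move=> m0 M0 hG; set w := z - G x.
have zE y : dotp y z = dotp (G x) y + dotp w y.
  by rewrite /w !dotp_lin (dotpC y z) addrC subrK.
have ub : ubound [set dotp y z - phi y | y in setT]
    (dotp x z - phi x + (2 * m)^-1 * dotp w w).
  move=> _ [y _ <-]; have /andP[lo _] := hG x y.
  have := dotp_ge0 (w - m *: (y - x)); move: lo; rewrite /bregman !zE.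
  have -> : dotp w y = dotp w x + dotp w (y - x) by rewrite !dotp_lin; ring.
  have -> : dotp (G x) y = dotp (G x) x + dotp (G x) (y - x).
    by rewrite !dotp_lin; ring.
  clearbody w; move: (y - x) => v lo.
  rewrite !dotp_lin (dotpC v w) => sq.
  have : m * (dotp w v - m / 2 * dotp v v) <= m * ((2 * m)^-1 * dotp w w).
    have -> : m * ((2 * m)^-1 * dotp w w) = dotp w w / 2.
      by field; rewrite gt_eqF.
    lra.
  rewrite ler_pM2l //; lra.
have ne : [set dotp y z - phi y | y in setT] !=set0.
  by exists (dotp x z - phi x), x.
apply/andP; split; last by rewrite lerBlDl; exact: ge_sup.
rewrite lerBrDl.
(* the maximizer for the upper quadratic *)
pose y := x + M^-1 *: w.
apply: (@le_trans _ _ (dotp y z - phi y)); last first.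
  apply: (@ub_le_sup _ [set dotp y z - phi y | y in setT]); last by exists y.
  by eexists; exact: ub.
have /andP[_] := hG x y; rewrite /bregman !zE /y.
rewrite (addrC x) addrK; clearbody w; rewrite !dotp_lin.
have -> : M / 2 * (M^-1 * (M^-1 * dotp w w)) = (2 * M)^-1 * dotp w w.
  by field; rewrite gt_eqF.
have -> : M^-1 * dotp w w = 2 * ((2 * M)^-1 * dotp w w).
  by field; rewrite gt_eqF.
lra.
Qed.

(** A quadratic remainder does not contribute to the difference quotients. *)
Lemma grad_unique (C : R) h z g :
  (forall v, `|h (z + v) - h z - dotp g v| <= C * dotp v v) -> grad h z = g.
Proof.
move=> hC; apply/colP => i; rewrite mxE; set v := delta_mx i 0.
rewrite -(dotp_delta g i) -/v.
rewrite /derive; apply: cvg_lim; first exact: Rhausdorff.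
apply/cvgrPdist_le => e e0.
have B0 : 0 < `|C| * dotp v v + 1.
  by rewrite ltr_wpDl // mulr_ge0 // dotp_ge0.
near=> s.
have sn0 : s != 0 by near: s; exact: nbhs_dnbhs_neq.
rewrite /= -[_ *: _]/(_ * _).
have := hC (s *: v); rewrite !dotp_lin [z + _]addrC => hs.
have -> : dotp g v - s^-1 * (h (s *: v + z) - h z) =
   - (s^-1 * (h (s *: v + z) - h z - s * dotp g v)) by field.
rewrite normrN normrM normfV ler_pdivrMl ?normr_gt0 //.
apply: le_trans hs _.
apply: (@le_trans _ _ (`|s| * (`|s| * (`|C| * dotp v v + 1)))).
  have -> : C * (s * (s * dotp v v)) = s ^+ 2 * (C * dotp v v) by ring.
  rewrite mulrA -expr2 real_normK ?num_real // ler_wpM2l ?sqr_ge0 //.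
  rewrite (@le_trans _ _ (`|C| * dotp v v)) ?lerDl //.
  by rewrite ler_wpM2r ?dotp_ge0 // ler_norm.
rewrite ler_pM2l ?normr_gt0 // -ler_pdivlMr //.
near: s; apply: dnbhs0_le; exact: divr_gt0.
Unshelve. all: by end_near. Qed.

Section Inverse.
Variables (m M : R) (phi : 'cV[R]_d -> R) (G : 'cV[R]_d -> 'cV[R]_d).
Hypotheses (m0 : 0 < m) (mM : m <= M) (hG : quad_bounded m M phi G).

(** [conjugate_bounds] at [z], with the Fenchel equality at [G x] substituted: a
    first-order expansion of the conjugate at [G x], with slope [x]. *)
Lemma conjugate_expansion x z :
  M^-1 / 2 * dotp (z - G x) (z - G x)
    <= conjugate phi z - conjugate phi (G x) - dotp x (z - G x)
    <= m^-1 / 2 * dotp (z - G x) (z - G x).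
Proof.
have M0 := lt_le_trans m0 mM.
have := conjugate_bounds x z m0 M0 hG.
have := conjugate_bounds x (G x) m0 M0 hG.
rewrite subrr dotp0l !mulr0 -eq_le eq_sym subr_eq0 => /eqP ->.
rewrite !invfM !(mulrC 2^-1); move: (dotp (z - G x) (z - G x)) => w.
by rewrite !dotp_lin => /andP[lo up]; apply/andP; split; lra.
Qed.

Lemma grad_conjugate x : grad (conjugate phi) (G x) = x.
Proof.
apply: (@grad_unique (m^-1 / 2)) => v.
have := conjugate_expansion x (G x + v); rewrite (addrC (G x)) addrK => /andP[lo up].
rewrite ger0_norm //; apply: le_trans lo; rewrite mulr_ge0 ?dotp_ge0 //.
by rewrite divr_ge0 // invr_ge0 (le_trans (ltW m0)).
Qed.

Lemma conjugate_quad_bounded : continuous phi ->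
  quad_bounded M^-1 m^-1 (conjugate phi) (grad (conjugate phi)).
Proof.
move=> cphi z z'.
have [x <-] := gradient_surjective z m0 mM cphi hG.
rewrite /bregman grad_conjugate; exact: conjugate_expansion.
Qed.

End Inverse.
End Conjugate.

(** * Bounds on positive definite quadratic forms *)

Section QuadForm.
Context {R : realType}.

Lemma dotp_trmx n p (A : 'M[R]_(n, p)) (x : 'cV[R]_p) (y : 'cV[R]_n) :
  dotp x (A^T *m y) = dotp (A *m x) y.
Proof. by rewrite /dotp trmx_mul mulmxA. Qed.

Lemma dotp_col n p (a c : 'cV[R]_n) (b e : 'cV[R]_p) :
  dotp (col_mx a b) (col_mx c e) = dotp a c + dotp b e.
Proof. by rewrite /dotp tr_col_mx mul_row_col mxE. Qed.

Lemma posdef_unitmx n (P : 'M[R]_n) : sym_posdef P -> P \in unitmx.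
Proof.
move=> [symP posP]; rewrite unitmxE unitfE; apply/negP => /det0P[v vn0 vP].
have := posP v^T; rewrite /quad_form -{1}symP -trmx_mul vP trmx0 dotpC dotp0l.
by rewrite ltxx -(inj_eq trmx_inj) trmxK trmx0 vn0 => /(_ isT).
Qed.

(** Each coordinate is [v i 0 = dotp (w i) (P *m v)] with [w i] the [i]-th column
    of the inverse of [P], so the Cauchy-Schwarz inequality for the scalar product
    of [P] bounds its square by [quad_form P (w i) * quad_form P v]. *)
Lemma posdef_quad_form_lower n (P : 'M[R]_n) : sym_posdef P ->
  exists2 C : R, 0 < C & forall v, dotp v v <= C * quad_form P v.
Proof.
move=> spP; have [symP posP] := spP.
have quad_ge0 v : 0 <= quad_form P v.
  have [->|/posP/ltW//] := eqVneq v 0.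
  by rewrite /quad_form dotp0l.
pose w i := invmx P *m delta_mx i 0 : 'cV[R]_n.
have Pw i : P *m w i = delta_mx i 0.
  by rewrite /w mulKVmx // posdef_unitmx.
(* the added ones keep the constants positive, also in dimension 0 *)
exists (1 + \sum_i (quad_form P (w i) + 1)).
  by rewrite ltr_pwDl // sumr_ge0 // => i _; rewrite addr_ge0.
move=> v; rewrite mulrDl mul1r ler_wpDl // dotpE mulr_suml.
apply: ler_sum => i _; rewrite -expr2.
have wPv : dotp (w i) (P *m v) = v i 0.
  by rewrite -{1}symP dotp_trmx Pw dotpC dotp_delta.
have vPw : dotp v (P *m w i) = v i 0 by rewrite Pw dotp_delta.
pose s := quad_form P (w i) + 1.
have s0 : 0 < s by rewrite ltr_wpDl.
pose c := v i 0 / s.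
have vE : v i 0 = c * s by rewrite /c divfK ?gt_eqF.
have := quad_ge0 (v - c *: w i).
rewrite {1}/quad_form mulmxBr -scalemxAr !dotp_lin wPv vPw.
rewrite -!/(quad_form P _) -/s vE.
have -> : quad_form P (w i) = s - 1 by rewrite /s addrK.
move=> h; have : s * (c ^+ 2 * s) <= s * quad_form P v.
  rewrite ler_pM2l //; have := sqr_ge0 c; lra.
lra.
Qed.

Lemma quad_form_upper n (P : 'M[R]_n) :
  exists2 C : R, 0 <= C & forall v, quad_form P v <= C * dotp v v.
Proof.
exists (\sum_i \sum_j `|P i j|).
  by apply: sumr_ge0 => i _; apply: sumr_ge0.
move=> v; rewrite /quad_form dotpE mulr_suml; apply: ler_sum => i _.
rewrite mxE mulr_sumr mulr_suml; apply: ler_sum => j _.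
have coord k : v k 0 ^+ 2 <= dotp v v.
  rewrite dotpE (bigD1 k) //= -expr2 lerDl sumr_ge0 // => l _.
  by rewrite -expr2 sqr_ge0.
have -> : v i 0 * (P i j * v j 0) = P i j * (v i 0 * v j 0) by ring.
apply: le_trans (ler_norm _) _; rewrite normrM ler_wpM2l //.
rewrite ler_norml; have := coord i; have := coord j.
have := sqr_ge0 (v i 0 - v j 0); have := sqr_ge0 (v i 0 + v j 0).
by move=> *; apply/andP; split; nra.
Qed.

End QuadForm.

(** * The linear matrix inequality as a dissipation inequality *)

Section Dissipation.
Context {R : realType}.

(** For [x] the current state and [u] the input, the value of the matrix at
    [(x, u)] is the change of storage along the step plus the supply rate [N] at
    the output. *)
Lemma quad_form_dissipation n p q (A P : 'M[R]_n) (B : 'M[R]_(n, p))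
    (C : 'M[R]_(q, n)) (D : 'M[R]_(q, p)) (N : 'M[R]_q) (r : R) x u :
  quad_form (block_mx (A^T *m P *m A - r *: P) (A^T *m P *m B)
                      (B^T *m P *m A) (B^T *m P *m B)
             + (row_mx C D)^T *m N *m row_mx C D) (col_mx x u) =
  quad_form P (A *m x + B *m u) - r * quad_form P x
  + quad_form N (C *m x + D *m u).
Proof.
rewrite /quad_form mulmxDl dotpDr -!mulmxA dotp_trmx mul_row_col.
congr (_ + _); rewrite mul_block_col dotp_col mulmxBl -!mulmxA -scalemxAl.
rewrite !dotp_lin !dotp_trmx !mulmxDr !dotp_lin; ring.
Qed.

Lemma quad_form_diag n p (M : 'M[R]_n) (N : 'M[R]_p) a b :
  quad_form (block_mx M 0 0 N) (col_mx a b) = quad_form M a + quad_form N b.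
Proof. by rewrite /quad_form mul_block_col !mul0mx addr0 add0r dotp_col. Qed.

Lemma dotp_kdiag d (k1 k2 : R) (a1 a2 b1 b2 : 'cV[R]_d) :
  dotp (col_mx a1 a2) (kdiag d k1 k2 *m col_mx b1 b2) =
  k1 * dotp a1 b1 + k2 * dotp a2 b2.
Proof.
by rewrite /kdiag mul_block_col !mul0mx addr0 add0r !mul_scalar_mx dotp_col !dotp_lin.
Qed.

Lemma quad_form_Mmx d (k1 k2 : R) (a1 a2 b1 b2 : 'cV[R]_d) :
  quad_form (Mmx (kdiag d k1 k2)) (col_mx (col_mx a1 a2) (col_mx b1 b2)) =
  2 * (k1 * dotp b1 a1 + k2 * dotp b2 a2).
Proof.
rewrite /quad_form /Mmx mul_block_col !mul0mx addr0 add0r dotp_col !dotp_kdiag.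
by rewrite (dotpC a1) (dotpC a2); ring.
Qed.

(** The middle block, the state of the memoryless sector filter, stays [0]. *)
Definition filter_state {d : nat} (e psi1 psi2 : 'cV[R]_d) :
    'cV[R]_(d + (d + d) + (d + d)) :=
  col_mx (col_mx e 0) (col_mx psi1 psi2).

(** Here [e] is the error on [z], [u1] and [u2] are the residuals of [f] and of the
    conjugate, so that [mub *: e + u2] is the error on [x], and [p1] and [p2] are
    the coresiduals. *)
Section ClosedLoop.
Context {d : nat}.
Variables (eta muf Lf mub Lb rhobar rho : R).
Variables (e u1 u2 psi1 psi2 : 'cV[R]_d).

Let u : 'cV[R]_(d + d) := col_mx u1 u2.
Let p1 : 'cV[R]_d := (Lf - muf) *: (mub *: e + u2) - u1.
Let p2 : 'cV[R]_d := (Lb - mub) *: e - u2.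

Lemma Cmx_Dmx : Cmx d mub *m e + Dmx d *m u = col_mx (mub *: e + u2) e.
Proof.
rewrite /Cmx /Dmx mul_col_mx mul_block_col !mul_scalar_mx !mul0mx add0r addr0.
by rewrite add_col_mx addr0 !scale1r.
Qed.

Lemma Kmx_output :
  Kmx d muf Lf mub Lb *m (Cmx d mub *m e + Dmx d *m u) - u = col_mx p1 p2.
Proof.
rewrite Cmx_Dmx /Kmx /kdiag mul_block_col !mul0mx addr0 add0r !mul_scalar_mx.
by rewrite opp_col_mx add_col_mx.
Qed.

Lemma filter_state_next :
  Ahat d eta muf Lf mub Lb *m filter_state e psi1 psi2
    + Bhat d eta muf Lf mub Lb *m u =
  filter_state (e - eta *: (u1 + muf *: (mub *: e + u2))) (- p1) (- p2).
Proof.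
rewrite /Ahat /Bhat /filter_state !mul_col_mx !mul_row_col !add_col_mx.
rewrite /ByPsi_s /APsi_s /BuPsi_s /ByPsi_w /APsi_w /BuPsi_w.
rewrite !mul0mx !addr0; congr (col_mx (col_mx _ _) _).
- rewrite /Amx !mul_scalar_mx.
  by apply/colP => i; rewrite !mxE; ring.
- by rewrite add0r mul0mx.
- rewrite mulmxDl -!mulmxA mul1mx addrA -mulmxDr mulNmx -opp_col_mx -Kmx_output.
  by rewrite opprB addrC.
Qed.

Lemma filter_output :
  Chat d muf Lf mub Lb rhobar *m filter_state e psi1 psi2
    + Dhat d muf Lf mub Lb *m u =
  col_mx (col_mx (col_mx p1 p2) u)
    (col_mx (col_mx (p1 + rhobar ^+ 2 *: psi1) (p2 + rhobar ^+ 2 *: psi2)) u).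
Proof.
have out : DyPsi_w d muf Lf mub Lb *m Cmx d mub *m e
    + (DyPsi_w d muf Lf mub Lb *m Dmx d + DuPsi_w d) *m u
    = col_mx (col_mx p1 p2) u.
  rewrite mulmxDl -!mulmxA addrA -mulmxDr /DyPsi_w /DuPsi_w.
  rewrite (mul_col_mx (Kmx _ _ _ _ _)) (mul_col_mx (- 1%:M)) mulNmx mul0mx !mul1mx.
  by rewrite add_col_mx add0r Kmx_output.
rewrite /Chat /Dhat -[DyPsi_s]/DyPsi_w -[DuPsi_s]/DuPsi_w.
move: (DyPsi_w _ _ _ _ _ *m _) (_ + DuPsi_w _) out => X Y out.
rewrite /filter_state !mul_col_mx !mul_row_col !mulmx0 !mul0mx !addr0.
rewrite add_col_mx addrAC out /CPsi_w !mul_col_mx mul_scalar_mx mul0mx.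
by rewrite !add_col_mx addr0 scale_col_mx add_col_mx.
Qed.

(** The matrix inequality read along the loop: the stored quantity [quad_form P],
    discounted by [rho ^+ 2], decreases by at least the outputs of the sector
    filter (weights [a1], [a2]) and of the off-by-one filter ([b1], [b2]). *)
Lemma LMI_dissipation P (a1 a2 b1 b2 : R) :
  negsemidef (LMI_mx eta muf Lf mub Lb rhobar rho P (kdiag d a1 a2) (kdiag d b1 b2)) ->
  quad_form P (filter_state (e - eta *: (u1 + muf *: (mub *: e + u2))) (- p1) (- p2))
  + 2 * (a1 * dotp u1 p1 + a2 * dotp u2 p2)
  + 2 * (b1 * dotp u1 (p1 + rhobar ^+ 2 *: psi1)
         + b2 * dotp u2 (p2 + rhobar ^+ 2 *: psi2))
  <= rho ^+ 2 * quad_form P (filter_state e psi1 psi2).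
Proof.
move=> /(_ (col_mx (filter_state e psi1 psi2) u)).
rewrite /LMI_mx quad_form_dissipation filter_state_next filter_output.
rewrite quad_form_diag !quad_form_Mmx; lra.
Qed.

End ClosedLoop.
End Dissipation.

Theorem theorem4 (R : realType) (d : nat) (hd : (0 < d)%N)
    (eta muf Lf muphi Lphi rhobar rho : R)
    (f phi : 'cV[R]_d -> R) (xopt : 'cV[R]_d)
    (heta : 0 < eta)
    (hmuf : 0 < muf) (hLf : muf <= Lf)
    (hmuphi : 0 < muphi) (hLphi : muphi <= Lphi)
    (hf : S_class muf Lf f) (hphi : S_class muphi Lphi phi)
    (hxopt : is_minimizer f xopt)
    (hrhobar : 0 <= rhobar) (hrho : rhobar <= rho) (hrho1 : rho <= 1)
    (hLMI : exists (P : 'M[R]_(d + (d + d) + (d + d)))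
                   (alpha1 alpha2 beta1 beta2 : R),
      [/\ sym_posdef P,
          0 <= alpha1 /\ 0 <= alpha2,
          0 <= beta1 /\ 0 <= beta2 &
          negsemidef
            (LMI_mx eta muf Lf Lphi^-1 muphi^-1 rhobar rho P
               (kdiag d alpha1 alpha2) (kdiag d beta1 beta2))]) :
  converges_with_rate eta f phi (grad phi xopt) rho.
Proof.
case: hLMI => P [a1] [a2] [b1] [b2] [posP [a10 a20] [b10 b20] lmi].
have Lphi0 := lt_le_trans hmuphi hLphi.
have Lf0 := lt_le_trans hmuf hLf.
have rho0 := le_trans hrhobar hrho.
have cphi : continuous phi.
  by move=> x; apply: differentiable_continuous; case: hphi => [[]].
have qf := S_class_quad_bounded hf.
have qphi := S_class_quad_bounded hphi.
have qconj := conjugate_quad_bounded hmuphi hLphi qphi cphi.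
set G := grad (conjugate phi) in qconj.
set zopt := grad phi xopt.
have Gopt : G zopt = xopt := grad_conjugate hmuphi hLphi qphi xopt.
have fopt : grad f xopt = 0 := minimizer_gradient0 Lf0 qf hxopt.
have mM : Lphi^-1 <= muphi^-1 by rewrite lef_pV2 ?posrE.
pose r1 := residual muf (grad f) xopt.
pose r2 := residual Lphi^-1 G zopt.
pose p1 := coresidual muf Lf (grad f) xopt.
pose p2 := coresidual Lphi^-1 muphi^-1 G zopt.
pose q1 := potential muf Lf f (grad f) xopt.
pose q2 := potential Lphi^-1 muphi^-1 (conjugate phi) G zopt.
have q1_ge0 x : 0 <= q1 x by exact: potential_ge0.
have q2_ge0 z : 0 <= q2 z by exact: potential_ge0.
have sector1 x : q1 x <= dotp (r1 x) (p1 x) by exact: potential_le_sector.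
have sector2 z : q2 z <= dotp (r2 z) (p2 z) by exact: potential_le_sector.
have rhobar01 : 0 <= rhobar ^+ 2 <= 1.
  by rewrite sqr_ge0 expr_le1 // (le_trans hrho).
have incr1 x y : q1 x - rhobar ^+ 2 * q1 y <=
    dotp (r1 x) (p1 x + rhobar ^+ 2 *: - p1 y).
  by rewrite scalerN; exact: potential_discounted_increment.
have incr2 z y : q2 z - rhobar ^+ 2 * q2 y <=
    dotp (r2 z) (p2 z + rhobar ^+ 2 *: - p2 y).
  by rewrite scalerN; exact: potential_discounted_increment.
have r1E x : r1 x + muf *: (x - xopt) = grad f x.
  by rewrite /r1 /residual fopt subr0 subrK.
have r2E z : Lphi^-1 *: (z - zopt) + r2 z = G z - xopt.
  by rewrite /r2 /residual Gopt addrC subrK.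
have p1E x : (Lf - muf) *: (x - xopt) - r1 x = p1 x by [].
have p2E z : (muphi^-1 - Lphi^-1) *: (z - zopt) - r2 z = p2 z by [].
have p1_opt : p1 xopt = 0 by exact: coresidual_anchor.
have p2_opt : p2 zopt = 0 by exact: coresidual_anchor.
have q1_opt : q1 xopt = 0 by exact: potential_anchor.
have q2_opt : q2 zopt = 0 by exact: potential_anchor.
clearbody r1 r2 p1 p2 q1 q2.
(* V w z is the Lyapunov function at the point z reached after the point w *)
pose xi w z := filter_state (z - zopt) (- p1 (G w)) (- p2 w).
pose V w z := quad_form P (xi w z) + 2 * (b1 * q1 (G w) + b2 * q2 w).
have descent w z : V z (z - eta *: grad f (G z)) <= rho ^+ 2 * V w z.
  have := LMI_dissipation (z - zopt) (r1 (G z)) (r2 z) (- p1 (G w)) (- p2 w) lmi.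
  rewrite r2E r1E p1E p2E [z - zopt - _]addrAC -/(xi w z).
  rewrite -/(xi z (z - eta *: grad f (G z))) => diss.
  have sector := addr_ge0
    (mulr_ge0 a10 (le_trans (q1_ge0 (G z)) (sector1 (G z))))
    (mulr_ge0 a20 (le_trans (q2_ge0 z) (sector2 z))).
  have rr : rhobar ^+ 2 <= rho ^+ 2 by rewrite ler_pXn2r ?nnegrE.
  have drop q qw i : 0 <= qw -> q - rhobar ^+ 2 * qw <= i -> q - rho ^+ 2 * qw <= i.
    by move=> qw0; apply: le_trans; rewrite lerB // ler_wpM2r.
  have i1 := ler_wpM2l b10 (drop _ _ _ (q1_ge0 (G w)) (incr1 (G z) (G w))).
  have i2 := ler_wpM2l b20 (drop _ _ _ (q2_ge0 w) (incr2 z w)).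
  rewrite /V; move: diss sector i1 i2; clear.
  move: (dotp _ _) (dotp _ _) (dotp _ _) (dotp _ _) => s1 s2 t1 t2.
  move: (quad_form P (xi w z)) (quad_form P (xi z (z - _))) => Q Q'.
  move: (q1 (G z)) (q1 (G w)) (q2 z) (q2 w) => q1z q1w q2z q2w.
  move: (rho ^+ 2) => r diss sector i1 i2; lra.
have [C1 C10 lowP] := posdef_quad_form_lower posP.
have [C2 C20 upP] := quad_form_upper P.
have VC w z : dotp (z - zopt) (z - zopt) <= C1 * V w z.
  apply: (@le_trans _ _ (C1 * quad_form P (xi w z))).
    apply: le_trans (lowP _); rewrite /xi /filter_state !dotp_col -!addrA lerDl.
    by rewrite !addr_ge0 ?dotp_ge0.
  by rewrite ler_pM2l // lerDl mulr_ge0 // addr_ge0 // mulr_ge0.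
have V0 z : V zopt z <= C2 * dotp (z - zopt) (z - zopt).
  rewrite /V /xi Gopt q1_opt q2_opt p1_opt p2_opt !mulr0 addr0 mulr0 addr0.
  apply: le_trans (upP _) _.
  by rewrite /filter_state !oppr0 !dotp_col !dotp0l !addr0.
(* the added 1 makes the constant positive when C2 = 0 *)
exists (Num.sqrt (C1 * C2) + 1); first by rewrite ltr_wpDl ?sqrtr_ge0.
move=> x z md k.
have zS j : z j.+1 = z j - eta *: grad f (G (z j)) by case: (md j).
(* starting from the optimum as previous point makes the initial memory zero *)
pose prev j := if j is i.+1 then z i else zopt.
have Vk : V (prev k) (z k) <= (rho ^+ 2) ^+ k * V zopt (z 0%N).
  elim: k => [|k IH]; first by rewrite mul1r.
  rewrite zS exprS -mulrA; apply: le_trans (descent (prev k) _) _.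
  by rewrite ler_wpM2l // sqr_ge0.
have : enorm (z k - zopt) <= Num.sqrt (C1 * C2) * rho ^+ k * enorm (z 0%N - zopt).
  rewrite -ler_sqr ?nnegrE ?mulr_ge0 ?exprn_ge0 ?sqrtr_ge0 //.
  rewrite !exprMn !enormE sqr_sqrtr ?mulr_ge0 ?(ltW C10) //.
  apply: le_trans (VC (prev k) _) _.
  rewrite exprAC -!mulrA ler_pM2l // mulrCA.
  apply: le_trans Vk _; rewrite ler_wpM2l ?exprn_ge0 ?sqr_ge0 //; exact: V0.
move=> h; apply: le_trans h _.
by rewrite ler_wpM2r ?sqrtr_ge0 // ler_wpM2r ?exprn_ge0 // lerDl.
Qed.
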